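(* Let $(E,\leqslant,\mathfrak{c})$ be an enriched qoset and let $\mathfrak{s}$ be a closure operator on $E$ that absorbs $\sim$. Let $\mathcal{K}$ be a collection of subsets of $E$. Assume that, for some collection $\mathcal{V}$ of subsets of $E$ that generates $\mathfrak{s}$ (i.e. $\mathfrak{s}=\langle\cdot\rangle_{\mathcal{V}}$), the collection $\{K\setminus V:K\in\mathcal{K},V\in\mathcal{V}\}$ has the Krein--Milman property with respect to $\mathfrak{c}$. Then $\mathcal{K}$ has the Krein--Milman property with respect to $\mathfrak{c}*\mathfrak{s}$.
   Context: A qoset $(E,\leqslant)$ is a set with a reflexive transitive relation; $x\sim y$ means $x\leqslant y$ and $y\leqslant x$; $[x]$ is the $\sim$-class of $x$ and $[A]=\bigcup_{a\in A}[a]$. $\downarrow A=\{x:\exists a\in A,\,x\leqslant a\}$. A preclosure operator on $E$ is a map $\mathfrak{c}:2^E\to2^E$ with $A\subseteq\mathfrak{c}(A)\subseteq\mathfrak{c}(B)$ whenever $A\subseteq B$; it is a closure operator if moreover $\mathfrak{c}(\mathfrak{c}(A))=\mathfrak{c}(A)$ for all $A$. An enriched qoset $(E,\leqslant,\mathfrak{c})$ is a qoset with a preclosure operator such that $\downarrow\mathfrak{c}(A)=\mathfrak{c}(A)$ for all $A\subseteq E$. A preclosure operator $\mathfrak{s}$ absorbs $\sim$ if $[\mathfrak{s}(A)]=\mathfrak{s}(A)=\mathfrak{s}([A])$ for all $A\subseteq E$. For a collection $\mathcal{V}$ of subsets of $E$, $\langle A\rangle_{\mathcal{V}}=\bigcap\{V\in\mathcal{V}:V\supseteq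 A\}$ (the empty intersection being $E$). The convolution product is $(\mathfrak{c}*\mathfrak{s})(A)=\bigcap_{B\subseteq E}\big(\mathfrak{c}(A\cap B)\cup\mathfrak{s}(A\setminus B)\big)$. For a preclosure operator $\mathfrak{t}$ on $E$ and $A\subseteq E$, $\mathrm{ex}_{\mathfrak{t}}A=\{x\in A:x\notin\mathfrak{t}(A\setminus[x])\}$. A collection $\mathcal{K}$ of subsets of $E$ has the Krein--Milman property with respect to $\mathfrak{t}$ if $\mathfrak{t}(K)=\mathfrak{t}(\mathrm{ex}_{\mathfrak{t}}K)$ for all $K\in\mathcal{K}$. *)

(* Defs.v *)
From mathcomp Require Import all_boot all_order.
From mathcomp Require Import boolp classical_sets.

Set Implicit Arguments.
Unset Strict Implicit.
Unset Printing Implicit Defensive.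

Local Open Scope classical_set_scope.
Local Open Scope order_scope.

(* Qosets are [preorderType]s: the Boolean order and the choice structure are
   no restriction, since [boolp] provides both classically on any type. *)

Definition qequiv d (E : preorderType d) (x y : E) : bool :=
  (x <= y) && (y <= x).

Definition qclass d (E : preorderType d) (x : E) : set E :=
  [set y | qequiv x y].

Definition saturation d (E : preorderType d) (A : set E) : set E :=
  \bigcup_(a in A) qclass a.

(* [classical_sets.down] requires antisymmetry. *)
Definition downset d (E : preorderType d) (A : set E) : set E :=
  [set x | exists2 a, A a & x <= a].

Definition preclosure_operator (E : Type) (c : set E -> set E) : Prop :=
  forall A B : set E, A `<=` B -> A `<=` c A /\ c A `<=` c B.

Definition closure_operator (E : Type) (c : set E -> set E) : Prop :=
  preclosure_operator c /\ forall A : set E, c (c A) = c A.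

(* [c] turns the qoset [E] into an enriched qoset. *)
Definition enriches d (E : preorderType d) (c : set E -> set E) : Prop :=
  preclosure_operator c /\ forall A : set E, downset (c A) = c A.

Definition absorbs_qequiv d (E : preorderType d) (s : set E -> set E) : Prop :=
  forall A : set E, saturation (s A) = s A /\ s A = s (saturation A).

(* [smallest VV A] is the intersection of the members of [VV] containing [A]
   ([setT] if there are none); it need not itself belong to [VV]. *)
Definition generates (E : Type) (VV : set (set E)) (s : set E -> set E) : Prop :=
  forall A : set E, s A = smallest VV A.

Definition convolution (E : Type) (c s : set E -> set E) (A : set E) : set E :=
  \bigcap_(B in [set: set E]) (c (A `&` B) `|` s (A `\` B)).

Definition extreme_points d (E : preorderType d) (t : set E -> set E)
    (A : set E) : set E :=
  [set x | A x /\ ~ t (A `\` qclass x) x].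

Definition Krein_Milman d (E : preorderType d) (t : set E -> set E)
    (KK : set (set E)) : Prop :=
  forall K : set E, KK K -> t K = t (extreme_points t K).

(* Hence [extreme_points] and [Krein_Milman] are meaningful for [c * s]. *)
Lemma preclosure_convolution (E : Type) (c s : set E -> set E) :
  preclosure_operator c -> preclosure_operator s ->
  preclosure_operator (convolution c s).
Proof.
move=> cP sP A B AB; split=> x.
  move=> Ax D _; have [Dx|nDx] := pselect (D x).
    by left; apply: (cP _ _ (@subset_refl _ _)).1.
  by right; apply: (sP _ _ (@subset_refl _ _)).1.
move=> tx D _; case: (tx D I) => [cx|sx]; [left|right].
  by apply: (cP _ _ _).2 cx; apply: setSI.
by apply: (sP _ _ _).2 sx; apply: setSD.
Qed.

(* Main.v *)
Require Import Defs.
From mathcomp Require Import all_boot all_order.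
From mathcomp Require Import boolp classical_sets.

Local Open Scope classical_set_scope.

(** Let [VV] generate [s]. In the convolution it is enough to split [A] along
    the complements of the members [V] of [VV], and since each [V] is closed for
    [s], the part of [A] inside [V] may be replaced by [V] itself: thus
    [(c * s)(A)] is the intersection of the sets [c (A \ V)] together with [V]
    ([convolution_generatedE]).

    With this formula the theorem is a comparison for one [V] at a time. Outside
    [V], only [c] on [K \ V] matters, so the [c]-extreme points of [K \ V] are
    [(c * s)]-extreme in [K] ([extreme_points_setD]). The Krein-Milman property
    of [K \ V] then shows that [c (K \ V)] is contained in [c (A \ V)], where
    [A] is the set of [(c * s)]-extreme points of [K]; hence [(c * s)(K)] is
    contained in [(c * s)(A)]. The other inclusion is monotonicity. *)

Lemma preclosure_mono (E : Type) (c : set E -> set E) :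
  preclosure_operator c -> {homo c : A B / A `<=` B}.
Proof. by move=> cP A B AB; have [] := cP _ _ AB. Qed.

(** Splittings along complements of generators suffice: if the splitting of [A]
    along [B] excludes [x], some [V] in [VV] contains [A \ B] but not [x], and the
    splitting along the complement of [V] excludes [x] as well. *)
Lemma convolution_generatedE (E : Type) (c s : set E -> set E)
    (VV : set (set E)) (A : set E) :
  preclosure_operator c -> generates VV s ->
  convolution c s A = \bigcap_(V in VV) (c (A `\` V) `|` V).
Proof.
move=> cP sE; apply/seteqP; split=> x.
  move=> tx V VVV; have [cx|] := tx (~` V) I; first by left; rewrite setDE.
  rewrite subEset setDE setCK sE => sx; right; apply: sx; split=> //.
move=> tx B _; apply: contrapT => /not_orP[ncx].
rewrite sE => /existsNP[V /not_implyP[[VVV ABV] nVx]].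
have [cx|//] := tx V VVV; apply: ncx.
(* As [V] contains [A \ B], the set [A \ V] lies in [B]. *)
apply: preclosure_mono cx => // y [Ay nVy]; split=> //.
by apply: contrapT => nBy; apply: nVy; apply: ABV.
Qed.

(** A [c]-extreme point [x] of [K \ V] is excluded from [(c * s)(K \ [x])] by the
    term of index [V] of the preceding formula, because
    removing [V] and removing the class of [x] commute. *)
Lemma extreme_points_setD d (E : preorderType d) (c s : set E -> set E)
    (VV : set (set E)) (K V : set E) :
  preclosure_operator c -> generates VV s -> VV V ->
  extreme_points c (K `\` V) `<=` extreme_points (convolution c s) K `\` V.
Proof.
move=> cP sE VVV x [[Kx nVx] ncx]; split=> //; split=> //.
rewrite (convolution_generatedE _ _ _ _ _ cP sE) => /(_ V VVV)[cx|//].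
by apply: ncx; rewrite subEset setDDl setUC -setDDl.
Qed.

Theorem theorem8p10 (d : Order.disp_t) (E : preorderType d)
    (c s : set E -> set E) (KK : set (set E))
    (c_enriches : enriches c)
    (s_closure : closure_operator s)
    (s_absorbs : absorbs_qequiv s)
    (KM_diff : exists2 VV : set (set E), generates VV s &
       Krein_Milman c [set K `\` V | K in KK & V in VV]) :
  Krein_Milman (convolution c s) KK.
Proof.
have cP := c_enriches.1; have [VV sE KM] := KM_diff => K KKK.
apply/seteqP; split; last first.
  apply: preclosure_mono; last by move=> x [].
  exact: (preclosure_convolution cP s_closure.1).
rewrite !(convolution_generatedE _ _ _ _ _ cP sE) => x tx V VVV.
have [cx|Vx] := tx V VVV; [left|by right].
move: cx; rewrite KM; last by exists K => //; exists V.
apply: preclosure_mono => //.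
exact: (extreme_points_setD _ _ _ _ _ _ _ cP sE VVV).
Qed.
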